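(* Let $k$ be a positive integer and let $G$ be a $k$-colourable $3K_1$-free graph. Then $G$ is $(k+1)$-mixing, and the diameter of $\mathcal{R}_{k+1}(G)$ is at most $4|V(G)|$.
   Context: All graphs are finite and simple. A graph is $3K_1$-free if it has no stable set of three vertices. A $k$-colouring of $G$ is a map $\alpha: V(G) \to \{1,\dots,k\}$ with $\alpha(u) \ne \alpha(v)$ for every edge $uv$. The $k$-recolouring graph $\mathcal{R}_k(G)$ has the $k$-colourings of $G$ as vertices, two colourings being adjacent if they differ on exactly one vertex. $G$ is $k$-mixing if $\mathcal{R}_k(G)$ is connected. *)

(* Defs.v *)
From mathcomp Require Import all_boot.

Set Implicit Arguments.
Unset Strict Implicit.
Unset Printing Implicit Defensive.

Record sgraph := SGraph {
  vertex :> finType;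
  adj : rel vertex;
  adj_sym : symmetric adj;
  adj_irr : irreflexive adj }.

Section Graph.
Variable G : sgraph.

Definition stable (S : {set G}) : bool :=
  [forall u in S, forall v in S, ~~ adj u v].

Definition is_3K1_free : Prop := forall S : {set G}, stable S -> #|S| <> 3.

Definition connected : Prop := forall x y : G, connect (@adj G) x y.

Definition walk_of_length (x y : G) (n : nat) : bool :=
  [exists p : n.-tuple G, path (@adj G) x p && (last x p == y)].

(* Distances between connected vertices are at most #|G|.-1, so the search
   range suffices; if y is not reachable from x the value is #|G|. *)
Definition dist (x y : G) : nat := find (walk_of_length x y) (iota 0 #|G|).

(* Meaningful only when G is connected. *)
Definition diameter : nat := \max_(x : G) \max_(y : G) dist x y.

Variable k : nat.

(* The colours 1, ..., k are represented by the elements 0, ..., k-1 of 'I_k. *)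
Definition proper_colouring (a : {ffun G -> 'I_k}) : bool :=
  [forall u, forall v, adj u v ==> (a u != a v)].

Definition colouring : finType := {a : {ffun G -> 'I_k} | proper_colouring a}.

Definition colourable : Prop :=
  exists a : {ffun G -> 'I_k}, proper_colouring a.

Definition recolour (a b : colouring) : bool :=
  #|[set v : G | val a v != val b v]| == 1.

Lemma recolour_sym : symmetric recolour.
Proof.
by move=> a b; congr (_ == _); apply: eq_card => v; rewrite !inE eq_sym.
Qed.

Lemma recolour_irr : irreflexive recolour.
Proof.
by move=> a; rewrite /recolour eq_card0 // => v; rewrite !inE eqxx.
Qed.

Definition recolouring_graph : sgraph := SGraph recolour_sym recolour_irr.

End Graph.

Definition mixing (k : nat) (G : sgraph) : Prop :=
  connected (recolouring_graph G k).

(* Main.v *)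
Require Import Defs.
From mathcomp Require Import all_boot.

(** Fix a [k]-colouring [g]; all colour classes have at most two vertices.  Any
    [(k+1)]-colouring [a] can be turned into one with the same classes as [g] in
    at most [n] steps: repeatedly pick a class [S] of [g] that is not a class of
    [a] and a colour [c] used by [a] only inside [S], and recolour [S] with [c].
    If [a] misses a colour, that colour works; otherwise [a] has more classes
    than [g], hence more singletons, and a singleton class of [a] that lies in a
    two-vertex class of [g] provides [c].  Two [(k+1)]-colourings with the
    classes of [g] then differ by a relabelling with a spare colour, which takes
    at most [2n] steps, as each vertex moves at most twice.  Hence the bound
    [n + 2n + n]. *)

(** * Walks of bounded length *)

Definition reach (G : sgraph) (m : nat) (x y : G) : Prop :=
  exists p, [/\ path (@adj G) x p, last x p = y & size p <= m].

Lemma reach0 (G : sgraph) (x : G) : reach G 0 x x.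
Proof. by exists [::]. Qed.

Lemma reach_le (G : sgraph) m n (x y : G) :
  m <= n -> reach G m x y -> reach G n x y.
Proof. by move=> le_mn [p [? ? /leq_trans le_pm]]; exists p; split; auto. Qed.

Lemma reach_trans (G : sgraph) m n (x y z : G) :
  reach G m x y -> reach G n y z -> reach G (m + n) x z.
Proof.
move=> [p [xp <- le_p]] [r [yr <- le_r]]; exists (p ++ r).
by rewrite cat_path last_cat size_cat xp yr leq_add.
Qed.

Lemma reach_sym (G : sgraph) m (x y : G) : reach G m x y -> reach G m y x.
Proof.
move=> [p [xp <- le_p]]; exists (rev (belast x p)); split.
- by rewrite rev_path (eq_path (e' := @adj G)) // => u v; rewrite adj_sym.
- by case: p {xp le_p} => //= z p; rewrite rev_cons last_rcons.
- by rewrite size_rev size_belast.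
Qed.

Lemma reach_connect (G : sgraph) m (x y : G) :
  reach G m x y -> connect (@adj G) x y.
Proof. by move=> [p [xp <- _]]; apply/connectP; exists p. Qed.

Lemma dist_reach (G : sgraph) m (x y : G) : reach G m x y -> dist x y <= m.
Proof.
move=> [p [xp yE le_p]]; apply: leq_trans le_p.
have walk_p : walk_of_length x y (size p).
  by apply/existsP; exists (in_tuple p); rewrite /= xp yE /=.
(* [dist] searches only lengths below [#|G|]; for a longer walk, [find] is still bounded by the
   length of the searched list. *)
rewrite /dist; have [lt_p|le_p] := ltnP (size p) #|G|; last first.
  by apply: leq_trans le_p; rewrite -[leqRHS](size_iota 0) find_size.
rewrite leqNgt; apply/negP => /(before_find 0).
by rewrite nth_iota // add0n walk_p.
Qed.

(** [phi] pays for the walk: a move of length [m] lowers it by at least [m], so the lengths add up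
    to at most [phi x]. *)
Lemma reach_descent (G : sgraph) (phi : G -> nat) (P : pred G) :
    (forall x, P x -> 0 < phi x ->
       exists y m, [/\ 0 < m, reach G m x y, m + phi y <= phi x & P y]) ->
  forall x, P x -> exists y, [/\ reach G (phi x) x y, P y & phi y = 0].
Proof.
move=> step x; have [n] := ubnP (phi x).
elim: n x => // n IHn x; rewrite ltnS => le_n Px.
have [phi0|/(step x Px)[y [m [m_gt0 x_y le_phi Py]]]] := posnP (phi x).
  by exists x; split=> //; rewrite phi0; exact: reach0.
have [|z [y_z Pz phi0]] := IHn y _ Py.
  by apply: leq_trans le_n; apply: leq_trans le_phi; rewrite -add1n leq_add2r.
by exists z; split=> //; apply: reach_le le_phi _; apply: reach_trans y_z.
Qed.

(** * Recolouring a vertex and a stable set *)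

Lemma colouringP (G : sgraph) q (a : colouring G q) u v :
  adj u v -> val a u != val a v.
Proof. by case: a => a /= /forallP/(_ u)/forallP/(_ v)/implyP. Qed.

Lemma recolour_vertex (G : sgraph) q (a : colouring G q) x c :
  (forall u, adj x u -> val a u != c) ->
  exists2 b : colouring G q, reach (recolouring_graph G q) 1 a b
    & forall u, val b u = if u == x then c else val a u.
Proof.
move=> free_c; pose b := [ffun u => if u == x then c else val a u].
have b_proper : proper_colouring b.
  apply/'forall_'forall_implyP => u v; rewrite !ffunE.
  have [->|_] := eqVneq u x; have [->|_] := eqVneq v x.
  - by rewrite adj_irr.
  - by rewrite eq_sym => /free_c.
  - by rewrite adj_sym => /free_c.
  - exact: colouringP.
exists (Sub b b_proper) => [|u]; last by rewrite SubK ffunE.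
(* [recolour] asks for exactly one difference, so giving [x] its own colour again is the empty
   walk. *)
have [axc|axc] := eqVneq (val a x) c.
  have -> : Sub b b_proper = a; last by exact: reach_le (reach0 _ _).
  by apply/val_inj/ffunP => u; rewrite SubK ffunE; case: eqP => // ->.
exists [:: Sub b b_proper]; rewrite /= andbT; split=> //.
rewrite /recolour; apply/cards1P; exists x; apply/setP => u.
by rewrite !inE ffunE; case: (eqVneq u x) => [->|_]; rewrite ?axc ?eqxx.
Qed.

(** The vertices of [S] move one at a time. Every intermediate colouring is proper, because [c]
    occurs only inside [S] and [S] spans no edge. *)
Lemma recolour_set (G : sgraph) q (a : colouring G q) (S : {set G}) c :
  stable S -> (forall u, val a u = c -> u \in S) ->
  exists2 b : colouring G q, reach (recolouring_graph G q) #|S| a b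
    & forall u, val b u = if u \in S then c else val a u.
Proof.
move=> /'forall_in_'forall_in_negP S_stable c_in_S.
have: S \subset S by [].
(* Induction over subsets [T] of [S]; the hypothesis on [c] keeps the full [S]. *)
move: {1 3 4}S => T; elim: {T}#|T| {-2}T (erefl #|T|) => [|n IHn] T.
  move=> T0 _; exists a => [|u]; first by rewrite T0; exact: reach0.
  by rewrite (cards0_eq T0) inE.
move=> Tn TS; have /card_gt0P[x xT] : 0 < #|T| by rewrite Tn.
have Tx : #|T :\ x| = n by move: Tn; rewrite (cardsD1 x) xT => -[].
have [b' a_b' b'E] := IHn _ Tx (subset_trans (subD1set T x) TS).
have [u xu|b b'_b bE] := recolour_vertex _ _ b' x c.
  apply/negP; rewrite b'E; case: ifP => [/setD1P[_ uT] _|_ /eqP/c_in_S uS].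
    exact: (S_stable x (subsetP TS x xT) u (subsetP TS u uT)).
  exact: (S_stable x (subsetP TS x xT) u uS).
exists b => [|u]; last by rewrite bE b'E !inE; case: eqP => [->|]; rewrite ?xT.
by rewrite Tn -addn1 -Tx; apply: reach_trans b'_b.
Qed.

(** * Colour classes and their number *)

Lemma stable_class (G : sgraph) q (a : {ffun G -> 'I_q}) c :
  proper_colouring a -> stable [set u | a u == c].
Proof.
move=> /'forall_'forall_implyP a_proper.
apply/'forall_in_'forall_in_negP => u; rewrite inE => /eqP au v.
by rewrite inE => /eqP av /a_proper; rewrite au av eqxx.
Qed.

Lemma card_stable_le2 (G : sgraph) (S : {set G}) :
  is_3K1_free G -> stable S -> #|S| <= 2.
Proof.
move=> G_free /'forall_in_'forall_in_idP S_stable; rewrite leqNgt; apply/negP.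
move=> /card_geqP[s [s_uniq s3 sS]].
have cardT : #|[set:: s]| = 3 by rewrite cardsE (card_uniqP s_uniq).
apply: (G_free _ _ cardT); apply/'forall_in_'forall_in_idP => u.
by rewrite inE => /sS uS v; rewrite inE => /sS; apply: S_stable.
Qed.

Section SmallClasses.

Variables (T : finType) (q : nat) (a : {ffun T -> 'I_q}).
Hypothesis class_le2 : forall c, #|[set u | a u == c]| <= 2.

Let single v := #|[set u | a u == a v]| == 1.

(** A nonempty class is one vertex of weight 2 or two vertices of weight 1. As its weight is always
    2, more colours in use force more singletons. *)
Lemma sum_class c :
  \sum_(v | a v == c) (1 + single v) = 2 * (0 < #|[set u | a u == c]|).
Proof.
rewrite (eq_bigr (fun=> 1 + (#|[set u | a u == c]| == 1))); last first.
  by move=> v /eqP <-.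
rewrite sum_nat_const -(cardsE [pred v | a v == c]) /=.
by move: (class_le2 c); case: #|_| => [|[|[]]].
Qed.

Lemma sum_single :
  \sum_v (1 + single v) = 2 * \sum_c (0 < #|[set u | a u == c]|).
Proof.
by rewrite (partition_big a xpredT) //= big_distrr; apply: eq_bigr => c _;
   exact: sum_class.
Qed.

End SmallClasses.

(** * Reaching the classes of [g] *)

Section SameClasses.

Variables (G : sgraph) (k : nat) (g : {ffun G -> 'I_k}).
Hypotheses (G_free : is_3K1_free G) (g_proper : proper_colouring g).

(** Each class of [g] is contained in this set or disjoint from it, so its size is a suitable
    potential for moving whole classes of [g]. *)
Definition bad (a : colouring G k.+1) : {set G} :=
  [set v | [exists u, (val a u == val a v) != (g u == g v)]].

Lemma badPn (a : colouring G k.+1) v :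
  reflect (forall u, (val a u == val a v) = (g u == g v)) (v \notin bad a).
Proof.
rewrite inE negb_exists; apply: (iffP forallP) => E u.
  by have := E u; rewrite negbK => /eqP.
by rewrite negbK E.
Qed.

Lemma bad_free_colour (a : colouring G k.+1) : bad a != set0 ->
  exists2 v, v \in bad a & exists c, forall u, val a u = c -> g u = g v.
Proof.
move=> /set0Pn[v v_bad].
have [/existsP[c c_free]|] := boolP [exists c, [forall u, val a u != c]].
  exists v => //; exists c => u auc.
  by move/forallP/(_ u): c_free; rewrite auc eqxx.
rewrite negb_exists => /forallP a_surj.
have g2 c : #|[set u | g u == c]| <= 2.
  by apply: card_stable_le2 G_free _; apply: stable_class.
have a2 c : #|[set u | val a u == c]| <= 2.
  by apply: card_stable_le2 G_free _; apply: stable_class (valP a).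
(* All [k.+1] colours are in use here, so [a] has total weight [2 * k.+1] and [g] at most [2 * k]:
   some singleton of [a] is not one of [g]. *)
have /existsP[w /andP[aw gw]] :
  [exists w, (#|[set u | val a u == val a w]| == 1)
             && (#|[set u | g u == g w]| != 1)].
  rewrite -[[exists _, _]]negbK negb_exists; apply/negP => /forallP le_single.
  have: 2 * k.+1 <= 2 * k.
    apply: (@leq_trans (\sum_v (1 + (#|[set u | val a u == val a v]| == 1)))).
      rewrite (sum_single _ _ _ a2) leq_mul2l /= -[leqLHS]card_ord -sum1_card.
      apply: leq_sum => c _; rewrite lt0b; apply/card_gt0P.
      have := a_surj c; rewrite negb_forall => /existsP[u].
      by rewrite negbK => auc; exists u; rewrite inE.
    apply: (@leq_trans (\sum_v (1 + (#|[set u | g u == g v]| == 1)))).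
      apply: leq_sum => v' _; rewrite leq_add2l.
      by have := le_single v'; do 2!case: (_ == 1).
    rewrite (sum_single _ _ _ g2) leq_mul2l /= -[leqRHS]card_ord -sum1_card.
    by apply: leq_sum => c _; exact: leq_b1.
  by rewrite leq_mul2l /= ltnn.
have w_bad : w \in bad a.
  apply/negPn/negP => /badPn E; move: gw; rewrite -(eqP aw) => /eqP[].
  by apply: eq_card => u; rewrite !inE E.
(* Only [w] itself has this colour, so the condition is trivial. *)
exists w => //; exists (val a w) => u /eqP auw.
have /cards1P[z class_w] := aw.
have: u \in [set z] by rewrite -class_w inE.
have: w \in [set z] by rewrite -class_w inE.
by rewrite !inE => /eqP-> /eqP->.
Qed.

(** Giving [c] to a whole class [S] of [g] repairs all of [S]. Good vertices outside [S] stay good,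
    since [c] was used only inside [S]. *)
Lemma bad_step (a : colouring G k.+1) : bad a != set0 ->
  exists b m, [/\ 0 < m, reach (recolouring_graph G k.+1) m a b
                & m + #|bad b| <= #|bad a|].
Proof.
move=> /bad_free_colour[v v_bad [c c_in]].
pose S := [set u | g u == g v].
have [||b a_b bE] := recolour_set _ _ a S c.
- exact: stable_class.
- by move=> u /c_in; rewrite inE => ->.
have S_bad : S \subset bad a.
  apply/subsetP => u; rewrite inE => /eqP guv.
  apply: contraLR v_bad => /badPn E; apply/badPn => w.
  by rewrite -guv -E; have /eqP-> : val a v == val a u by rewrite E guv.
exists b, #|S|; split=> //; first by apply/card_gt0P; exists v; rewrite inE.
rewrite -(cardsID S (bad a)) (setIidPr S_bad) leq_add2l.
apply/subset_leq_card/subsetP => w; apply: contraLR.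
rewrite inE negb_and negbK => w_ok; apply/badPn => u.
rewrite !bE !inE; move: w_ok; rewrite inE.
have [->|gwv /= /badPn E] := eqVneq (g w) (g v).
  have [_|guv _] := eqVneq (g u) (g v); first by rewrite eqxx.
  by apply: contraNF guv => /eqP/c_in->.
have [guv|//] := eqVneq (g u) (g v).
rewrite guv [RHS]eq_sym (negPf gwv); apply: contraNF gwv => /eqP caw.
by rewrite (c_in w).
Qed.

Lemma reach_same_classes (a : colouring G k.+1) :
  exists2 b : colouring G k.+1, reach (recolouring_graph G k.+1) #|G| a b
    & forall u v, (val b u == val b v) = (g u == g v).
Proof.
have [|//|b [a_b _ /eqP]] :=
    reach_descent (recolouring_graph G k.+1) (fun a => #|bad a|) xpredT _ a.
  move=> a' _; rewrite card_gt0 => /bad_step[b [m [? ? ?]]]; exists b, m.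
  by split.
rewrite cards_eq0 => /eqP b_good; exists b => [|u v].
  exact: reach_le (max_card _) a_b.
by apply/badPn; rewrite b_good inE.
Qed.

End SameClasses.

(** * Relabelling with a spare colour *)

Section Relabel.

Variables (G : sgraph) (k : nat) (g : {ffun G -> 'I_k}).

Definition same_classes (a : colouring G k.+1) : bool :=
  [forall u, forall v, (val a u == val a v) == (g u == g v)].

Lemma same_classesP (a : colouring G k.+1) :
  reflect (forall u v, (val a u == val a v) = (g u == g v)) (same_classes a).
Proof. exact: 'forall_'forall_eqP. Qed.

Lemma spare_colour (a : colouring G k.+1) :
  same_classes a -> exists c, forall u, val a u != c.
Proof.
move=> /same_classesP aE.
have [/existsP[c /forallP]|] := boolP [exists c, [forall u, val a u != c]].
  by exists c.
rewrite negb_exists => /forallP a_surj.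
have pre c : exists u, val a u == c.
  have := a_surj c; rewrite negb_forall => /existsP[u].
  by rewrite negbK; exists u.
(* Were all colours used, sending each to the [g]-colour of a preimage would inject ['I_k.+1] into
   ['I_k]. *)
have := @leq_card _ _ (fun c => g (xchoose (pre c))).
rewrite !card_ord ltnn => absurd; case/negP: isT; apply/negP/absurd.
move=> c d /eqP; rewrite -aE.
by rewrite (eqP (xchooseP (pre c))) (eqP (xchooseP (pre d))) => /eqP.
Qed.

Variable b : colouring G k.+1.
Hypothesis b_classes : same_classes b.

(* The number of times [v] may still have to move: once to its final colour if
   its present colour is not used by [b], and possibly once more, to the spare
   colour, if it blocks a colour used by [b]. *)
Definition moves_left (a : colouring G k.+1) (v : G) : nat :=
  (val a v != val b v) * (1 + [exists u, val b u == val a v]).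

(** Each vertex of the moved class pays for its own move; for any other vertex [moves_left] depends
    only on its unchanged colour. *)
Lemma move_class (a : colouring G k.+1) w c :
    same_classes a -> (forall u, val a u != c) ->
    (forall (a' : colouring G k.+1) v, val a v = val a w -> val a' v = c ->
       moves_left a' v < moves_left a v) ->
  exists a' m, [/\ 0 < m, reach (recolouring_graph G k.+1) m a a',
    m + \sum_v moves_left a' v <= \sum_v moves_left a v & same_classes a'].
Proof.
move=> a_classes c_free decr; pose S := [set u | val a u == val a w].
have [||a' a_a' a'E] := recolour_set _ _ a S c.
- exact: stable_class (valP a).
- by move=> u /eqP; rewrite (negPf (c_free u)).
exists a', #|S|; split=> //.
- by apply/card_gt0P; exists w; rewrite inE.
- rewrite -sum1_card big_mkcond -big_split /=; apply: leq_sum => v _.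
  have [vS|vS] := ifPn.
    by apply: decr; [move: vS; rewrite inE => /eqP | rewrite a'E vS].
  by rewrite /moves_left a'E (negPf vS).
apply/same_classesP => u v; rewrite -(same_classesP _ a_classes) !a'E !inE.
have [auw|auw] := eqVneq (val a u) (val a w);
  have [avw|avw] := eqVneq (val a v) (val a w) => //.
- by rewrite auw avw !eqxx.
- by rewrite auw eq_sym (negPf (c_free v)) eq_sym (negPf avw).
- by rewrite avw (negPf auw) (negPf (c_free u)).
Qed.

Lemma relabel_step (a : colouring G k.+1) :
    same_classes a -> 0 < \sum_v moves_left a v ->
  exists a' m, [/\ 0 < m, reach (recolouring_graph G k.+1) m a a',
    m + \sum_v moves_left a' v <= \sum_v moves_left a v & same_classes a'].
Proof.
move=> a_classes; rewrite lt0n sum_nat_eq0 negb_forall => /existsP[v].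
rewrite /= muln_eq0 negb_or eqb0 negbK => /andP[v_wrong _].
have abE u u' : (val a u == val a u') = (val b u == val b u').
  by rewrite (same_classesP _ a_classes) (same_classesP _ b_classes).
(* If the target of a misplaced class is unoccupied, the class moves there for good. *)
have [/existsP[w /andP[w_wrong /forallP w_free]]|] :=
    boolP [exists w, (val a w != val b w) && [forall u, val a u != val b w]].
  apply: (move_class a w _ a_classes w_free) => a' u auw a'u.
  have /eqP buw : val b u == val b w by rewrite -abE auw.
  by rewrite /moves_left a'u auw buw eqxx w_wrong.
rewrite negb_exists => /forallP blocked.
have {}blocked u : val a u != val b u -> exists u', val a u' = val b u.
  move=> u_wrong; have := blocked u; rewrite u_wrong negb_forall.
  by case/existsP=> u'; rewrite negbK => /eqP; exists u'.
(* Otherwise the class occupying the target of [v] is parked on a spare colour. *)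
have [c c_free] := spare_colour a a_classes.
have [w awv] := blocked v v_wrong.
apply: (move_class a w c a_classes c_free) => a' u auw a'u.
(* Were [u] in place, [v] would share its target, hence its class, and be in place too. *)
have u_wrong : val a u != val b u.
  rewrite auw awv; apply: contra v_wrong => bvu.
  by move: bvu; rewrite -abE auw awv.
(* A vertex with target [c] would be misplaced, hence blocked, yet [a] does not use [c]. So a parked
   vertex has at most one move left. *)
have c_unused : [exists u', val b u' == c] = false.
  apply/existsP => -[u' /eqP bu'].
  have [|w' aw'] := blocked u'; first by rewrite bu' c_free.
  by have := c_free w'; rewrite aw' bu' eqxx.
have -> : moves_left a u = 2.
  rewrite /moves_left u_wrong; suff -> : [exists u', val b u' == val a u] by [].
  by apply/existsP; exists v; rewrite auw awv.
by rewrite /moves_left a'u c_unused; case: (_ != _).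
Qed.

(** [moves_left] is at most 2 at each vertex, and its sum vanishes only at [b]. *)
Lemma reach_relabel (a : colouring G k.+1) :
  same_classes a -> reach (recolouring_graph G k.+1) (2 * #|G|) a b.
Proof.
move=> a_classes.
have [a' [a_a' _ /eqP]] := reach_descent (recolouring_graph G k.+1)
    (fun a => \sum_v moves_left a v) same_classes relabel_step a a_classes.
rewrite sum_nat_eq0 => /forallP a'0.
have <- : a' = b.
  apply/val_inj/ffunP => v; apply/eqP.
  by have := a'0 v; rewrite /= muln_eq0 eqb0 negbK orbF.
apply: reach_le a_a'; rewrite mulnC -sum_nat_const; apply: leq_sum => v _.
by rewrite /moves_left; case: (_ != _); case: [exists _, _].
Qed.

End Relabel.

Theorem theorem2 (k : nat) (G : sgraph) (k_gt0 : 0 < k)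
  (G_colourable : colourable G k) (G_free : is_3K1_free G) :
  mixing k.+1 G /\ diameter (recolouring_graph G k.+1) <= 4 * #|G|.
Proof.
have [g g_proper] := G_colourable.
have reach4 (x y : recolouring_graph G k.+1) : reach _ (4 * #|G|) x y.
  have [a x_a aE] := reach_same_classes _ _ _ G_free g_proper x.
  have [b y_b bE] := reach_same_classes _ _ _ G_free g_proper y.
  have a_b : reach (recolouring_graph G k.+1) (2 * #|G|) a b.
    by apply: (reach_relabel _ _ g); apply/same_classesP.
  have := reach_trans _ _ _ _ _ _ (reach_trans _ _ _ _ _ _ x_a a_b)
            (reach_sym _ _ _ _ y_b).
  by rewrite -mulSn addnC -mulSn.
split; first by move=> x y; exact: reach_connect (reach4 x y).
by do 2![apply/bigmax_leqP => ? _]; exact: dist_reach.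
Qed.
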